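(* Let $A,B$ be compact connected topological spaces and let $f:A\to\mathbb{R}^n$ and $g:B\to\mathbb{R}^n$ be embeddings with $f(A)\cap g(B)=\emptyset$ that are a link pair. If a continuous map $F:\mathbb{R}^n\to\mathbb{R}^n$ is group homotopic to a homeomorphism $\Pi:\mathbb{R}^n\to\mathbb{R}^n$, then $F$ does not separate $f(A)$ and $g(B)$.
   Context: Linked / link pair: continuous maps $f:A\to\mathbb{R}^n$ and $g:B\to\mathbb{R}^n$ with disjoint images are unlinked if there are continuous homotopies $H_A:A\times[0,1]\to\mathbb{R}^n$ and $H_B:B\times[0,1]\to\mathbb{R}^n$ with $H_A(\cdot,0)=f$, $H_B(\cdot,0)=g$, $H_A(A\times\{t\})\cap H_B(B\times\{t\})=\emptyset$ for all $t\in[0,1]$, and disjoint compact balls $D,\bar D\subset\mathbb{R}^n$ (subsets homeomorphic to the closed unit ball) with $H_A(A\times\{1\})\subset D$ and $H_B(B\times\{1\})\subset\bar D$. Otherwise $f$ and $g$ are linked, and $f,g$ (or $f(A),g(B)$) are called a link pair. Group homotopy: for a topological space $X$ and maps $P,Q:X\to X$, $P$ is group homotopic to $Q$ if there is a continuous $H:X\times[0,1]\to X$ with $H(x,0)=Q(x)$, $H(x,1)=P(x)$ for all $x\in X$, and $H(x,t_1+t_2)=H(H(x,t_1),t_2)$ for all $x\in X$ and all $t_1,t_2\in[0,1]$ with $t_1+t_2\in[0,1]$. Separate: a continuous map $F:\mathbb{R}^n\to\mathbb{R}^m$ separates compact sets $A_1,\dots,A_k\subset\mathbb{R}^n$ if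 there are mutually disjoint embedded balls $D_1,\dots,D_k$ in $\mathbb{R}^m$ with $F(A_i)\subset D_i$ for $i=1,\dots,k$. *)

(* Defs.v *)
From mathcomp Require Import all_boot all_order all_algebra.
From mathcomp Require Import all_classical all_reals all_analysis.

Set Implicit Arguments.
Unset Strict Implicit.
Unset Printing Implicit Defensive.

Import Order.TTheory GRing.Theory Num.Theory.
Import numFieldNormedType.Exports.

Local Open Scope classical_set_scope.
Local Open Scope ring_scope.

(* R^n is the type 'rV[R]_n, whose library topology is the product topology. *)

Definition homeomorphism (X Y : topologicalType) (h : X -> Y) : Prop :=
  continuous h /\
  exists k : Y -> X, [/\ continuous k, cancel h k & cancel k h].

(* Homeomorphism onto the image: the last clause says that f is open as a map
   onto its range with the subspace topology. *)
Definition embedding (X Y : topologicalType) (f : X -> Y) : Prop :=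
  [/\ continuous f, injective f &
      forall U : set X, open U ->
        exists V : set Y, open V /\ f @` U = V `&` range f].

Definition homeomorphic_subsets (X Y : topologicalType)
    (D : set X) (E : set Y) : Prop :=
  exists (h : X -> Y) (k : Y -> X),
    [/\ {within D, continuous h}, {within E, continuous k},
        (forall x, D x -> E (h x) /\ k (h x) = x) &
        (forall y, E y -> D (k y) /\ h (k y) = y)].

(* The library norm on 'rV[R]_n is the sup norm, so the Euclidean unit ball is
   written out with a sum of squares. *)
Definition closed_unit_ball (R : realType) (n : nat) : set 'rV[R]_n :=
  [set x | \sum_(i < n) x 0 i ^+ 2 <= 1].

Definition embedded_ball (R : realType) (n : nat) (D : set 'rV[R]_n) : Prop :=
  homeomorphic_subsets D (@closed_unit_ball R n).

(* A map on X x [0,1] is represented by a function on X * R of which only the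
   restriction to this set is relevant. *)
Definition cylinder (R : realType) (X : topologicalType) : set (X * R) :=
  [set: X] `*` `[0, 1].

Definition unlinked (R : realType) (n : nat) (A B : topologicalType)
    (f : A -> 'rV[R]_n) (g : B -> 'rV[R]_n) : Prop :=
  exists (HA : A * R -> 'rV[R]_n) (HB : B * R -> 'rV[R]_n),
    [/\ {within @cylinder R A, continuous HA},
        {within @cylinder R B, continuous HB},
        (forall a, HA (a, 0) = f a),
        (forall b, HB (b, 0) = g b) &
        (forall t : R, 0 <= t <= 1 ->
           range (fun a => HA (a, t)) `&` range (fun b => HB (b, t)) = set0)] /\
    exists D D' : set 'rV[R]_n,
      [/\ embedded_ball D, embedded_ball D', D `&` D' = set0,
          range (fun a => HA (a, 1)) `<=` D &
          range (fun b => HB (b, 1)) `<=` D'].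

Definition linked (R : realType) (n : nat) (A B : topologicalType)
    (f : A -> 'rV[R]_n) (g : B -> 'rV[R]_n) : Prop :=
  ~ unlinked f g.

(* [group_homotopic R P Q]: P is the time-one map, Q the time-zero map. *)
Definition group_homotopic (R : realType) (X : topologicalType)
    (P Q : X -> X) : Prop :=
  exists H : X * R -> X,
    [/\ {within @cylinder R X, continuous H},
        (forall x, H (x, 0) = Q x),
        (forall x, H (x, 1) = P x) &
        (forall (x : X) (t1 t2 : R),
           0 <= t1 <= 1 -> 0 <= t2 <= 1 -> 0 <= t1 + t2 <= 1 ->
           H (x, t1 + t2) = H (H (x, t1), t2))].

(* Continuity of F and compactness of the sets K i are not part of this
   predicate; they are assumed where it is used. *)
Definition separates (R : realType) (n m k : nat)
    (F : 'rV[R]_n -> 'rV[R]_m) (K : 'I_k -> set 'rV[R]_n) : Prop :=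
  exists D : 'I_k -> set 'rV[R]_m,
    [/\ (forall i, embedded_ball (D i)),
        (forall i j, i != j -> D i `&` D j = set0) &
        (forall i, F @` K i `<=` D i)].

(* Main.v *)
Require Import Defs.
From mathcomp Require Import all_boot all_order all_algebra.
From mathcomp Require Import all_classical all_reals all_analysis.

Import Order.TTheory GRing.Theory Num.Theory.
Import numFieldNormedType.Exports.

Local Open Scope classical_set_scope.
Local Open Scope ring_scope.

(** If [F] separated the link, the group homotopy [H] from [Pi] to [F] would
    itself unlink it.  Two consequences of the semigroup law are used.

    At times [0 + 0] the law says that [Pi] is idempotent; an injective
    idempotent map is the identity, so the homotopies [(a, t) |-> H (f a, t)]
    and [(b, t) |-> H (g b, t)] do start at [f] and [g].

    At times [t + (1 - t)] the law says that [F] factors through [H (_, t)]: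
    points that meet at some time stay together until time 1.  Since [F] sends
    [range f] and [range g] into disjoint balls, the two images therefore never
    meet, and at time 1 they lie in these balls. *)

Lemma injective_idempotent_id (X : Type) (h : X -> X) :
  injective h -> (forall x, h (h x) = h x) -> forall x, h x = x.
Proof. by move=> injh hh x; apply: injh. Qed.

(** [H] is unconstrained at times outside [0, 1], so only continuity relative
    to the cylinder is available; it survives the composition because
    [(x, t) |-> (f x, t)] maps the cylinder over [X] into the one over [Y]. *)
Lemma continuous_cylinder_comp (R : realType) (X Y Z : topologicalType)
    (H : Y * R -> Z) (f : X -> Y) :
  continuous f -> {within @cylinder R Y, continuous H} ->
  {within @cylinder R X, continuous (fun p => H (f p.1, p.2))}.
Proof.
move=> cf /subspace_continuousP cH; apply/subspace_continuousP => -[x t] [_ It].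
have cft : (fun p : X * R => (f p.1, p.2)) @ nbhs (x, t) --> (f x, t).
  have cf1 : (fun p : X * R => f p.1) @ nbhs (x, t) --> f x.
    by apply: (cvg_comp _ f cvg_fst); exact: cf.
  exact: cvg_pair cf1 cvg_snd.
have cHft := cH (f x, t) (conj I It).
apply: cvg_comp cHft => U /cft.
by apply: (@filterS _ (nbhs (x, t))) => p Up [_ Ip]; exact: Up.
Qed.

(** The position at time [t] determines the position at time [1], by the
    semigroup law at [t + (1 - t)]. *)
Lemma semigroup_merge (R : realType) (X : Type) (H : X * R -> X)
    (HD : forall (x : X) (t1 t2 : R),
       0 <= t1 <= 1 -> 0 <= t2 <= 1 -> 0 <= t1 + t2 <= 1 ->
       H (x, t1 + t2) = H (H (x, t1), t2))
    (x y : X) (t : R) :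
  0 <= t <= 1 -> H (x, t) = H (y, t) -> H (x, 1) = H (y, 1).
Proof.
move=> tI Hxy; have sI : 0 <= 1 - t <= 1.
  by case/andP: tI => t0 t1; rewrite subr_ge0 t1 gerBl.
have tDs : t + (1 - t) = 1 by rewrite addrC subrK.
have HtD z : H (z, 1) = H (H (z, t), 1 - t).
  by rewrite -HD// tDs// ler01 lexx.
by rewrite !HtD Hxy.
Qed.

Theorem theorem4p1 (R : realType) (n : nat) (A B : topologicalType)
    (cptA : compact [set: A]) (conA : connected [set: A])
    (cptB : compact [set: B]) (conB : connected [set: B])
    (f : A -> 'rV[R]_n) (g : B -> 'rV[R]_n)
    (embf : embedding f) (embg : embedding g)
    (disj_fg : range f `&` range g = set0)
    (link_fg : linked f g)
    (F Pi : 'rV[R]_n -> 'rV[R]_n)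
    (contF : continuous F) (homeoPi : homeomorphism Pi)
    (FPi : group_homotopic R F Pi) :
  ~ separates F (tnth [tuple range f; range g]).
Proof.
move=> [D [ballD disjD subD]]; apply: link_fg.
case: FPi => H [cH H0 H1 HD].
have id0 x : H (x, 0) = x.
  rewrite H0; move: x; apply: injective_idempotent_id => [|x].
    by case: homeoPi => _ [k [_ + _]]; exact: can_inj.
  by rewrite -!H0 -HD ?addr0// lexx ler01.
have D01 : D 0 `&` D 1 = set0 by exact: disjD.
have FfD a : D 0 (F (f a)) by apply: (subD 0); exists (f a) => //; exists a.
have FgD b : D 1 (F (g b)) by apply: (subD 1); exists (g b) => //; exists b.
exists (fun p => H (f p.1, p.2)), (fun p => H (g p.1, p.2)); split.
  split => //=.
  - by apply: continuous_cylinder_comp cH; case: embf.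
  - by apply: continuous_cylinder_comp cH; case: embg.
  move=> t tI; apply/eqP/negPn/negP => /set0P[_ [[a _ <-] [b _ /esym Hab]]].
  have Fab : F (f a) = F (g b) by rewrite -!H1; exact: semigroup_merge tI Hab.
  by rewrite -[False]/(set0 (F (f a))) -D01; split; rewrite ?[in D 1 _]Fab.
exists (D 0), (D 1); split => // [_ [a _ <-]|_ [b _ <-]] /=.
  by rewrite H1.
by rewrite H1.
Qed.
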